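(* Let $f:\mathbb R^2\to\mathbb R^2$, $(p,q)\mapsto(\tilde p,\tilde q)$, be any invertible quadratic transformation $$\tilde p=a_{20}p^2+2a_{11}pq+a_{02}q^2+2a_{10}p+2a_{01}q+a_{00},$$ $$\tilde q=b_{20}p^2+2b_{11}pq+b_{02}q^2+2b_{10}p+2b_{01}q+b_{00}$$ with real coefficients, and suppose that its associated quadratic form $\omega_1$ is zero. Then $f$ reduces to the form $$\tilde p=p+q^2,\qquad \tilde q=q$$ at the expense of composing it with (invertible) linear transformations and origin shifts.
   Context: A polynomial transformation of $\mathbb R^2$ is a mapping $\mathbb R^2\to\mathbb R^2$ given by two polynomials in two variables; it is called quadratic if the degrees of its polynomials are not greater than two. Invertible means bijective as a map $\mathbb R^2\to\mathbb R^2$. The quadratic form associated with the quadratic transformation is the form on $\mathbb R^2$ given, for $\mathbf c=(c_1,c_2)\in\mathbb R^2$, by $$\omega_1(\mathbf c)=(a_{20}b_{11}-a_{11}b_{20})\,c_1^2+(a_{20}b_{02}-a_{02}b_{20})\,c_1c_2+(a_{11}b_{02}-a_{02}b_{11})\,c_2^2 .$$ The linear transformations and origin shifts (translations) may be applied both to the source variables $(p,q)$ and to the target variables $(\tilde p,\tilde q)$.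
   Formalization: The transformation is assumed to have at least one nonzero degree-two coefficient; without this the claim fails, e.g. for the identity map, which is invertible with zero form but reduces only to affine maps. *)

(* Defs.v *)
From HB Require Import structures.
From mathcomp Require Import all_boot all_order all_algebra.
From mathcomp Require Import reals.
Set Implicit Arguments.
Unset Strict Implicit.
Unset Printing Implicit Defensive.
Import Order.TTheory GRing.Theory Num.Theory.
Local Open Scope ring_scope.

Definition vec2 (R : realType) (x y : R) : 'cV[R]_2 := \col_(i < 2) [:: x; y]`_i.

(* The degree-one and mixed coefficients carry a factor 2, so that
   c20, c11, c02 are the entries of the symmetric matrix of the leading part. *)
Definition quad (R : realType) (c20 c11 c02 c10 c01 c00 : R) (p q : R) : R :=
  c20 * p ^+ 2 + 2 * c11 * p * q + c02 * q ^+ 2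
  + 2 * c10 * p + 2 * c01 * q + c00.

Definition omega1 (R : realType) (a20 a11 a02 b20 b11 b02 : R)
    (c : 'cV[R]_2) : R :=
  let c1 := c 0 0 in
  let c2 := c 1 0 in
  (a20 * b11 - a11 * b20) * c1 ^+ 2
  + (a20 * b02 - a02 * b20) * (c1 * c2)
  + (a11 * b02 - a02 * b11) * c2 ^+ 2.

Definition lin (R : realType) (A : 'M[R]_2) (x : 'cV[R]_2) : 'cV[R]_2 := A *m x.

Definition shift (R : realType) (u : 'cV[R]_2) (x : 'cV[R]_2) : 'cV[R]_2 := x + u.

(* Every finite composition of invertible linear maps and translations has
   the form shift u \o lin A, so one of each kind on either side suffices. *)
Definition reduces_to (R : realType) (f g : 'cV[R]_2 -> 'cV[R]_2) : Prop :=
  exists (A B : 'M[R]_2) (u v : 'cV[R]_2),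
    [/\ A \in unitmx, B \in unitmx
      & (shift v \o lin B) \o f \o (shift u \o lin A) =1 g].

Definition normal_form (R : realType) (x : 'cV[R]_2) : 'cV[R]_2 :=
  vec2 (x 0 0 + x 1 0 ^+ 2) (x 1 0).

(* Main.v *)
(* Since omega1 = 0 the two leading forms are proportional, so a nonzero
   linear combination of the two components is affine; surjectivity makes it
   nonconstant, and it can be taken as the coordinate q. On each line
   q = const the other component is then an injective quadratic polynomial
   in p, which forces its p^2 and p q terms to vanish and its p term not to;
   an affine change of the variable p then turns it into a nonzero multiple
   of p + q^2. *)
Require Import Defs.
From HB Require Import structures.
From mathcomp Require Import all_boot all_order all_algebra.
From mathcomp Require Import reals.
From mathcomp Require Import ring lra.
Set Implicit Arguments.
Unset Strict Implicit.
Unset Printing Implicit Defensive.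
Import Order.TTheory GRing.Theory Num.Theory.
Local Open Scope ring_scope.

Definition mx2 (R : realType) (a b c d : R) : 'M[R]_2 :=
  \matrix_(i < 2, j < 2) (nth [::] [:: [:: a; b]; [:: c; d]] i)`_j.

Lemma vec2E (R : realType) (x : 'cV[R]_2) : x = vec2 (x 0 0) (x 1 0).
Proof.
apply/colP => i; rewrite !mxE.
by case: i => [[|[|//]] hi] /=; congr (x _ _); apply: val_inj.
Qed.

Lemma vec2_inj (R : realType) (a b c d : R) :
  vec2 a b = vec2 c d -> a = c /\ b = d.
Proof.
by move=> e; move/colP: (e) => /(_ 0); move/colP: e => /(_ 1); rewrite !mxE.
Qed.

Lemma vec2D (R : realType) (a b c d : R) :
  vec2 a b + vec2 c d = vec2 (a + c) (b + d).
Proof. by apply/colP => i; rewrite !mxE; case: i => [[|[|//]]]. Qed.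

Lemma mul_mx2_vec2 (R : realType) (a b c d x y : R) :
  mx2 a b c d *m vec2 x y = vec2 (a * x + b * y) (c * x + d * y).
Proof.
apply/colP => i; rewrite !mxE !big_ord_recl big_ord0 !mxE addr0 /=.
by case: i => [[|[|//]]].
Qed.

Lemma mx2_unit (R : realType) (a b c d : R) :
  a * d - b * c != 0 -> mx2 a b c d \in unitmx.
Proof.
move=> h; rewrite unitmxE unitfE (expand_det_row _ 0).
rewrite !big_ord_recl big_ord0 /cofactor !det_mx11 !mxE /=.
by rewrite addr0 expr0 mul1r expr1 mulN1r mulrN.
Qed.

Lemma reduces_to_trans (R : realType) (f g h : 'cV[R]_2 -> 'cV[R]_2) :
  reduces_to f g -> reduces_to g h -> reduces_to f h.
Proof.
move=> [A [B [u [v [uA uB fg]]]]] [A' [B' [u' [v' [uA' uB' gh]]]]].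
exists (A *m A'), (B' *m B), (A *m u' + u), (B' *m v + v').
split; rewrite ?unitmx_mul ?uA ?uB ?uA' ?uB' // => x.
rewrite -gh /= -fg /= /shift /lin !mulmxDr !mulmxA.
by rewrite !addrA.
Qed.

Lemma reduces_to_inj (R : realType) (f g : 'cV[R]_2 -> 'cV[R]_2) :
  reduces_to f g -> injective f -> injective g.
Proof.
move=> [A [B [u [v [uA uB fg]]]]] f_inj x y; rewrite -!fg /= /shift /lin.
by move=> /addIr/(can_inj (mulKmx uB))/f_inj/addIr/(can_inj (mulKmx uA)).
Qed.

(* If a <> 0, the values at p and at - 2 b / a - p agree. *)
Lemma quadratic_inj (R : realType) (a b : R) :
  injective (fun p => a * p ^+ 2 + 2 * b * p) -> a = 0 /\ b != 0.
Proof.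
move=> inj; have a0 : a = 0.
  apply/eqP/negPn/negP => a0.
  have b0 : b = 0.
    have /inj/eqP : a * (- 2 * b / a) ^+ 2 + 2 * b * (- 2 * b / a)
                    = a * 0 ^+ 2 + 2 * b * 0 by field.
    rewrite mulf_eq0 invr_eq0 (negPf a0) orbF mulf_eq0 => /orP[/eqP|/eqP //].
    lra.
  have /inj : a * (- 1) ^+ 2 + 2 * b * (- 1) = a * 1 ^+ 2 + 2 * b * 1.
    by rewrite b0; ring.
  lra.
split=> //; apply/eqP => b0.
have /inj/eqP : a * 1 ^+ 2 + 2 * b * 1 = a * 0 ^+ 2 + 2 * b * 0.
  by rewrite a0 b0; ring.
by rewrite oner_eq0.
Qed.

Lemma quad_subst (R : realType) (a b c d e k m n m' n' x y : R) :
  quad a b c d e k (m * x + n * y) (m' * x + n' * y) =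
  quad (a * m ^+ 2 + 2 * b * m * m' + c * m' ^+ 2)
       (a * m * n + b * (m * n' + n * m') + c * m' * n')
       (a * n ^+ 2 + 2 * b * n * n' + c * n' ^+ 2)
       (d * m + e * m') (d * n + e * n') k x y.
Proof. rewrite /quad; ring. Qed.

(** With [S] the symmetric matrix of the form and [P] that of the substitution, the three vanishing
    expressions are the entries of [P^T S P]. Multiplying by the adjugate of [P] on the right and
    its transpose on the left gives [(det P)^2 S], whose entries are the combinations of [al], [be],
    [ga] below. *)
Lemma form_subst_eq0 (R : realType) (a b c m n m' n' : R) :
  m * n' - n * m' != 0 ->
  a * m ^+ 2 + 2 * b * m * m' + c * m' ^+ 2 = 0 ->
  a * m * n + b * (m * n' + n * m') + c * m' * n' = 0 ->
  a * n ^+ 2 + 2 * b * n * n' + c * n' ^+ 2 = 0 ->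
  [/\ a = 0, b = 0 & c = 0].
Proof.
move=> D0; set al := (X in X = 0); set be := (X in _ -> X = 0 -> _).
set ga := (X in _ -> _ -> X = 0 -> _) => al0 be0 ga0.
have D2 : (m * n' - n * m') ^+ 2 != 0 by rewrite expf_neq0.
split; apply: (mulIf D2); rewrite mul0r.
- transitivity (al * n' ^+ 2 - 2 * be * n' * m' + ga * m' ^+ 2).
    by rewrite /al /be /ga; ring.
  by rewrite al0 be0 ga0; ring.
- transitivity (- al * n * n' + be * (n' * m + n * m') - ga * m' * m).
    by rewrite /al /be /ga; ring.
  by rewrite al0 be0 ga0; ring.
transitivity (al * n ^+ 2 - 2 * be * n * m + ga * m ^+ 2).
  by rewrite /al /be /ga; ring.
by rewrite al0 be0 ga0; ring.
Qed.

Lemma reduces_triangular (R : realType) (a b c d e k : R)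
    (g : 'cV[R]_2 -> 'cV[R]_2) :
  (forall p q, g (vec2 p q) = vec2 (quad a b c d e k p q) q) ->
  injective g -> [|| a != 0, b != 0 | c != 0] ->
  reduces_to g (@normal_form R).
Proof.
move=> gE g_inj deg2.
have line q : a = 0 /\ b * q + d != 0.
  apply: quadratic_inj => p p' eqp.
  have /g_inj/vec2_inj[] // : g (vec2 p q) = g (vec2 p' q).
  by rewrite !gE; congr vec2; rewrite /quad; lra.
have [a0] := line 0; rewrite mulr0 add0r => d0.
have b0 : b = 0.
  (* For nonzero [b], the coefficient of [p] would vanish on the line [q = - d / b]. *)
  apply/eqP/negPn/negP => b0; have [_ /eqP] := line (- d / b).
  by apply; field.
move: deg2; rewrite a0 b0 eqxx /= => c0.
(* The source change is chosen so that [2 * d * p + 2 * e * q + k] becomes [c * p]. The first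
   component is then [c * (p + q ^+ 2)], and the target map divides it by [c]. *)
exists (mx2 (c / (2 * d)) (- e / d) 0 1), (mx2 c^-1 0 0 1),
  (vec2 (- k / (2 * d)) 0), 0.
have d2 : 2 * d != 0 by rewrite mulf_neq0 ?pnatr_eq0.
split; first by apply: mx2_unit; rewrite mulr0 subr0 mulr1 mulf_neq0 ?invr_eq0.
  by apply: mx2_unit; rewrite mulr0 subr0 mulr1 invr_eq0.
move=> x; rewrite [x]vec2E; move: (x 0 0) (x 1 0) => p q.
rewrite /= /shift /lin mul_mx2_vec2 vec2D gE mul_mx2_vec2 addr0 /normal_form !mxE /=.
by congr vec2; rewrite /quad ?a0 ?b0; field; rewrite ?c0 ?d0.
Qed.

(** The coefficients of [omega1] are the 2x2 minors of the two rows of leading coefficients, and its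
    values at three vectors make them vanish. A nonzero entry of the first row, with the entry below
    it, gives [(s, t)]; if that row is zero, [(1, 0)] works. Over the reals a nonzero sum of squares
    says that [(s, t)] is nonzero. *)
Lemma proportional_forms (R : realType) (a20 a11 a02 b20 b11 b02 : R) :
  (forall c : 'cV[R]_2, omega1 a20 a11 a02 b20 b11 b02 c = 0) ->
  exists s t : R, [/\ s ^+ 2 + t ^+ 2 != 0, s * a20 + t * b20 = 0,
    s * a11 + t * b11 = 0 & s * a02 + t * b02 = 0].
Proof.
move=> om0.
move: (om0 (vec2 1 0)) (om0 (vec2 0 1)) (om0 (vec2 1 1)).
rewrite /omega1 !mxE /= => h10 h01 h11.
have pos (x y : R) : y != 0 -> x ^+ 2 + y ^+ 2 != 0.
  by move=> y0; rewrite paddr_eq0 ?sqr_ge0 // !sqrf_eq0 (negPf y0) andbF.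
have [a20_0|/pos a20_0] := eqVneq a20 0; last first.
  by exists (- b20), a20; split=> //; lra.
have [a11_0|/pos a11_0] := eqVneq a11 0; last first.
  by exists (- b11), a11; split=> //; lra.
have [a02_0|/pos a02_0] := eqVneq a02 0; last first.
  by exists (- b02), a02; split=> //; lra.
exists 1, 0; split; rewrite ?a20_0 ?a11_0 ?a02_0; try ring.
by rewrite expr1n expr0n addr0 oner_eq0.
Qed.

Theorem theorem3p1 (R : realType)
    (a20 a11 a02 a10 a01 a00 b20 b11 b02 b10 b01 b00 : R)
    (f : 'cV[R]_2 -> 'cV[R]_2)
    (fE : forall p q : R,
       f (vec2 p q) = vec2 (quad a20 a11 a02 a10 a01 a00 p q)
                           (quad b20 b11 b02 b10 b01 b00 p q))
    (f_bij : bijective f)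
    (f_deg2 : [|| a20 != 0, a11 != 0, a02 != 0,
                  b20 != 0, b11 != 0 | b02 != 0])
    (omega1_eq0 : forall c : 'cV[R]_2, omega1 a20 a11 a02 b20 b11 b02 c = 0) :
  reduces_to f (@normal_form R).
Proof.
have [s [t [st0 h20 h11 h02]]] := proportional_forms omega1_eq0.
pose m := s * a10 + t * b10; pose n := s * a01 + t * b01.
pose k := s * a00 + t * b00; pose N := m ^+ 2 + n ^+ 2.
have affine p q : s * quad a20 a11 a02 a10 a01 a00 p q
    + t * quad b20 b11 b02 b10 b01 b00 p q = 2 * (m * p + n * q) + k.
  transitivity ((s * a20 + t * b20) * p ^+ 2 + 2 * (s * a11 + t * b11) * p * q
    + (s * a02 + t * b02) * q ^+ 2 + 2 * (m * p + n * q) + k).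
    by rewrite /quad /m /n /k; ring.
  by rewrite h20 h11 h02; ring.
have N0 : N != 0.
  rewrite paddr_eq0 ?sqr_ge0 // !sqrf_eq0; apply/negP => /andP[/eqP m0 /eqP n0].
  have [f' _ f'K] := f_bij.
  (* If [m = n = 0], the combination with weights [s], [t] is constantly [k], yet at the target
     point [(s * l, t * l)] it equals [k + 1]. *)
  pose l := (k + 1) / (s ^+ 2 + t ^+ 2).
  move: (f'K (vec2 (s * l) (t * l))); rewrite [f' _]vec2E fE => /vec2_inj[e1 e2].
  move: (affine (f' (vec2 (s * l) (t * l)) 0 0) (f' (vec2 (s * l) (t * l)) 1 0)).
  rewrite e1 e2 m0 n0.
  have -> : s * (s * l) + t * (t * l) = k + 1 by rewrite /l; field.
  lra.
(* The weights [(- t, s)], orthogonal to [(s, t)], provide the other target coordinate; the target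
   matrix then has determinant [- (s ^+ 2 + t ^+ 2)]. *)
pose c20 := s * b20 - t * a20; pose c11 := s * b11 - t * a11.
pose c02 := s * b02 - t * a02.
pose c10 := s * b10 - t * a10; pose c01 := s * b01 - t * a01.
pose c00 := s * b00 - t * a00.
have combE p q : - t * quad a20 a11 a02 a10 a01 a00 p q
    + s * quad b20 b11 b02 b10 b01 b00 p q = quad c20 c11 c02 c10 c01 c00 p q.
  by rewrite /quad /c20 /c11 /c02 /c10 /c01 /c00; ring.
(* New source axes: [(- n, m)] runs along the level lines of the affine combination, and [(m', n')]
   is normal to them, scaled so that [2 * (m * m' + n * n') = 1]. The combination thus becomes
   [q + k], and a target shift removes [k]. *)
pose m' := m / (2 * N); pose n' := n / (2 * N).
pose alpha := c20 * (- n) ^+ 2 + 2 * c11 * (- n) * m + c02 * m ^+ 2.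
pose beta := c20 * (- n) * m' + c11 * (- n * n' + m' * m) + c02 * m * n'.
pose gamma := c20 * m' ^+ 2 + 2 * c11 * m' * n' + c02 * n' ^+ 2.
pose delta := c10 * (- n) + c01 * m; pose epsilon := c10 * m' + c01 * n'.
pose g (x : 'cV[R]_2) :=
  vec2 (quad alpha beta gamma delta epsilon c00 (x 0 0) (x 1 0)) (x 1 0).
have N2 : 2 * N != 0 by rewrite mulf_neq0 ?pnatr_eq0.
have detE : - n * n' - m' * m = - 2^-1.
  by rewrite /m' /n'; move: N0 N2; rewrite /N => N0 N2; field.
have det0 : - n * n' - m' * m != 0.
  by rewrite detE oppr_eq0 invr_eq0 pnatr_eq0.
have fg : reduces_to f g.
  exists (mx2 (- n) m' m n'), (mx2 (- t) s s t), 0, (vec2 0 (- k)).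
  split.
  - exact: mx2_unit det0.
  - apply: mx2_unit; have -> : - t * t - s * s = - (s ^+ 2 + t ^+ 2) by ring.
    by rewrite oppr_eq0.
  move=> x; rewrite [x]vec2E; move: (x 0 0) (x 1 0) => p q.
  rewrite /= /shift /lin mul_mx2_vec2 addr0 fE mul_mx2_vec2 vec2D.
  rewrite combE affine addr0 quad_subst /g !mxE /=.
  congr vec2; rewrite /m' /n'; move: N0 N2; rewrite /N => N0 N2; field.
  by rewrite N0.
apply: (reduces_to_trans fg); apply: reduces_triangular.
- by move=> p q; rewrite /g !mxE.
- exact: reduces_to_inj fg (bij_inj f_bij).
(* If the new leading form vanished, so would that of the [(- t, s)] combination. The [(s, t)]
   combination has none either, so all leading coefficients of [f] would be zero, against
   [f_deg2]. *)
apply: contraT; rewrite !negb_or !negbK => /and3P[/eqP al0 /eqP be0 /eqP ga0].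
have [c20_0 c11_0 c02_0] := form_subst_eq0 det0 al0 be0 ga0.
have forms0 (x y : R) : s * x + t * y = 0 -> s * y - t * x = 0 -> x = 0 /\ y = 0.
  move=> h h'; split; apply: (mulIf st0); rewrite mul0r.
    transitivity (s * (s * x + t * y) - t * (s * y - t * x)); first by ring.
    by rewrite h h'; ring.
  transitivity (t * (s * x + t * y) + s * (s * y - t * x)); first by ring.
  by rewrite h h'; ring.
move: f_deg2; have [-> ->] := forms0 _ _ h20 c20_0.
have [-> ->] := forms0 _ _ h11 c11_0; have [-> ->] := forms0 _ _ h02 c02_0.
by rewrite eqxx.
Qed.
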